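(* Let $n\geq 2$ be an integer and let $\varepsilon>0$. Then any automorphism $\phi$ of the unit distance graph of the layer $L=\mathbb{R}^n\times[0,\varepsilon]\subset\mathbb{R}^{n+1}$ (with the standard Euclidean metric) is an isometry of $L$.
   Context: The unit distance graph of a metric space $V$ is the graph with vertex set $V$ in which two vertices are joined by an edge if and only if the distance between them is exactly $1$. An automorphism is a bijection of the vertex set that preserves both adjacency and non-adjacency. *)

(* Defs.v *)
From HB Require Import structures.
From mathcomp Require Import all_boot all_order all_algebra.
From mathcomp Require Import ring lra.
From mathcomp Require Import reals topology.

Set Implicit Arguments.
Unset Strict Implicit.
Unset Printing Implicit Defensive.

Import Order.TTheory GRing.Theory Num.Theory.
Local Open Scope ring_scope.

(* The norm that MathComp-Analysis puts on ['rV[R]_m] is the sup norm, hence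
   this separate definition. *)
Definition eucl_dist (R : realType) (m : nat) (x y : 'rV[R]_m) : R :=
  Num.sqrt (\sum_(i < m) (x 0 i - y 0 i) ^+ 2).

Section EuclDist.
Variables (R : realType) (m : nat).
Implicit Types (x y z : 'rV[R]_m) (a b : 'I_m -> R).

Lemma sum_sqr_ge0 a : 0 <= \sum_i a i ^+ 2.
Proof. by apply: sumr_ge0 => i _; rewrite sqr_ge0. Qed.

Lemma sum_cauchy_schwarz a b :
  (\sum_i a i * b i) ^+ 2 <= (\sum_i a i ^+ 2) * (\sum_i b i ^+ 2).
Proof.
set A := \sum_i a i ^+ 2; set B := \sum_i b i ^+ 2; set C := \sum_i a i * b i.
have B0 : 0 <= B by exact: sum_sqr_ge0.
have : 0 <= \sum_i (B * a i - C * b i) ^+ 2 by exact: sum_sqr_ge0.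
have -> : \sum_i (B * a i - C * b i) ^+ 2 = B * (A * B - C ^+ 2).
  transitivity (B ^+ 2 * A - B * C * 2 * C + C ^+ 2 * B); last by ring.
  rewrite [in RHS](mulr_sumr _ _ _ (B ^+ 2)) (mulr_sumr _ _ _ (B * C * 2)).
  rewrite (mulr_sumr _ _ _ (C ^+ 2)) -sumrB -big_split /=.
  by apply: eq_bigr => i _; ring.
move: B0; rewrite le_eqVlt => /predU1P[B0|B0]; last first.
  by rewrite pmulr_rge0 // subr_ge0.
have b0 i : b i = 0.
  have := psumr_eq0P (fun j _ => sqr_ge0 (b j)) (esym B0).
  by move=> /(_ i isT) /eqP; rewrite sqrf_eq0 => /eqP.
by rewrite -B0 mulr0 /C big1 ?expr0n // => i _; rewrite b0 mulr0.
Qed.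

Lemma eucl_distxx x : eucl_dist x x = 0.
Proof.
by rewrite /eucl_dist big1 ?sqrtr0 // => i _; rewrite subrr expr0n.
Qed.

Lemma eucl_dist_eq0 x y : eucl_dist x y = 0 -> x = y.
Proof.
move=> /eqP; rewrite sqrtr_eq0 => le0.
have /psumr_eq0P xy0 : \sum_(i < m) (x 0 i - y 0 i) ^+ 2 = 0.
  by apply/eqP; rewrite eq_le le0 sumr_ge0 // => i _; rewrite sqr_ge0.
apply/rowP => i; apply/eqP; rewrite -subr_eq0 -sqrf_eq0.
by rewrite xy0 // => j _; rewrite sqr_ge0.
Qed.

Lemma eucl_distC x y : eucl_dist x y = eucl_dist y x.
Proof.
by congr Num.sqrt; apply: eq_bigr => i _; rewrite -sqrrN opprB.
Qed.

Lemma eucl_dist_triangle y x z :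
  eucl_dist x z <= eucl_dist x y + eucl_dist y z.
Proof.
pose a i := x 0 i - y 0 i; pose b i := y 0 i - z 0 i.
have A0 := sum_sqr_ge0 a; have B0 := sum_sqr_ge0 b.
have xyz0 : 0 <= eucl_dist x y + eucl_dist y z by rewrite addr_ge0 ?sqrtr_ge0.
rewrite -(ger0_norm xyz0) -sqrtr_sqr ler_wsqrtr // sqrrD !sqr_sqrtr //.
have -> : \sum_(i < m) (x 0 i - z 0 i) ^+ 2 =
    \sum_i a i ^+ 2 + (\sum_i a i * b i) *+ 2 + \sum_i b i ^+ 2.
  rewrite -sumrMnl -!big_split /=; apply: eq_bigr => i _.
  by rewrite /a /b; ring.
rewrite lerD2r lerD2l lerMn2r /= -sqrtrM // (le_trans (ler_norm _)) //.
by rewrite -sqrtr_sqr ler_wsqrtr // sum_cauchy_schwarz.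
Qed.

End EuclDist.

(* The layer R^n x [0, eps], as a subspace of R^(n+1). *)
Record layer (R : realType) (n : nat) (eps : R) := Layer {
  layer_val : 'rV[R]_n.+1 ;
  _ : 0 <= layer_val 0 ord_max <= eps }.

HB.instance Definition _ (R : realType) (n : nat) (eps : R) :=
  [isSub for @layer_val R n eps].
HB.instance Definition _ (R : realType) (n : nat) (eps : R) :=
  [Choice of layer n eps by <:].

Section LayerMetric.
Variables (R : realType) (n : nat) (eps : R).
Implicit Types p q : layer n eps.

Definition layer_dist p q : R := eucl_dist (val p) (val q).

Let layer_distxx p : layer_dist p p = 0.
Proof. exact: eucl_distxx. Qed.

Let layer_dist_eq0 p q : layer_dist p q = 0 -> p = q.
Proof. by move/eucl_dist_eq0/val_inj. Qed.

Let layer_distC p q : layer_dist p q = layer_dist q p.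
Proof. exact: eucl_distC. Qed.

Let layer_dist_triangle q p r :
  layer_dist p r <= layer_dist p q + layer_dist q r.
Proof. exact: eucl_dist_triangle. Qed.

HB.instance Definition _ := isMetric.Build R (layer n eps)
  layer_distxx layer_dist_eq0 layer_distC layer_dist_triangle.

Lemma layer_mdistE p q : mdist p q = eucl_dist (val p) (val q).
Proof. by []. Qed.

End LayerMetric.

Definition unit_distance_graph (R : realType) (V : metricType R) : rel V :=
  [rel x y | mdist x y == 1].
Arguments unit_distance_graph {R} V.

Definition graph_automorphism (V : Type) (e : rel V) (phi : V -> V) : Prop :=
  bijective phi /\ forall x y, e (phi x) (phi y) = e x y.

Definition is_isometry (R : realType) (V : metricType R) (phi : V -> V) : Prop :=
  bijective phi /\ forall x y, mdist (phi x) (phi y) = mdist x y.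

(* Main.v *)
(* Two points with a common neighbour b have no other one exactly when b is
   their midpoint, so an automorphism preserves unit-step arithmetic
   progressions.  Those with a horizontal step u are the ones that extend
   forever, hence they go to progressions with a horizontal step u'.  Since the
   layer is convex, graph distance and Euclidean distance differ by at most 2;
   comparing two progressions at infinity gives |u' - v'| = |u - v| for all
   base points.  As horizontal vectors are multiples of sums of two unit
   vectors, translation by a horizontal w becomes translation by T w, where T
   is a norm-preserving additive bijection of the horizontal space.  Vertical
   segments shorter than 1 are then controlled by the neighbours q + w and
   q - w of p, and longer ones by repeated doubling. *)

Require Import Defs.
From mathcomp Require Import all_boot all_order all_algebra.
From mathcomp Require Import ring lra.
From mathcomp Require Import reals topology.

Import Order.TTheory GRing.Theory Num.Theory.

Local Open Scope ring_scope.

Set Implicit Arguments.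
Unset Strict Implicit.
Unset Printing Implicit Defensive.

(** * Inner product, horizontal and vertical vectors *)

Section Euclidean.
Context {R : realType} {n : nat}.
Local Notation V := 'rV[R]_n.+1.
Implicit Types (x y z u v w : V) (a b c r : R).

Definition dot x y : R := \sum_i x 0 i * y 0 i.

Lemma dotC x y : dot x y = dot y x.
Proof. by apply: eq_bigr => i _; rewrite mulrC. Qed.

Lemma dotDl x y z : dot (x + y) z = dot x z + dot y z.
Proof. by rewrite -big_split; apply: eq_bigr => i _; rewrite mxE mulrDl. Qed.

Lemma dotZl a x y : dot (a *: x) y = a * dot x y.
Proof. by rewrite mulr_sumr; apply: eq_bigr => i _; rewrite mxE mulrA. Qed.

Lemma dotNl x y : dot (- x) y = - dot x y.
Proof. by rewrite -scaleN1r dotZl mulN1r. Qed.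

Lemma dotDr x y z : dot z (x + y) = dot z x + dot z y.
Proof. by rewrite dotC dotDl !(dotC z). Qed.

Lemma dotZr a x y : dot x (a *: y) = a * dot x y.
Proof. by rewrite dotC dotZl dotC. Qed.

Lemma dotNr x y : dot x (- y) = - dot x y.
Proof. by rewrite dotC dotNl dotC. Qed.

Definition dotE := (dotDl, dotDr, dotNl, dotNr, dotZl, dotZr).

Lemma dot_ge0 x : 0 <= dot x x.
Proof. by apply: sumr_ge0 => i _; rewrite -expr2 sqr_ge0. Qed.

Lemma dot_delta x i : dot x (delta_mx 0 i) = x 0 i.
Proof.
rewrite /dot (bigD1 i) //= big1 ?addr0 => [|j ji]; rewrite mxE eqxx /=.
  by rewrite eqxx mulr1.
by rewrite (negPf ji) mulr0.
Qed.

Lemma dot_sqrD x y :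
  dot (x + y) (x + y) = dot x x + 2 * dot x y + dot y y.
Proof. by rewrite !dotE (dotC y x); ring. Qed.

Lemma dot_pythagoras a b x y : dot x y = 0 ->
  dot (a *: x + b *: y) (a *: x + b *: y) =
  a ^+ 2 * dot x x + b ^+ 2 * dot y y.
Proof. by move=> xy; rewrite !dotE (dotC y x) xy; ring. Qed.

Definition norm x : R := Num.sqrt (dot x x).

Lemma eucl_distE x y : eucl_dist x y = norm (x - y).
Proof.
by congr Num.sqrt; apply: eq_bigr => i _; rewrite !mxE expr2.
Qed.

Lemma norm_ge0 x : 0 <= norm x.
Proof. exact: sqrtr_ge0. Qed.

Lemma norm_sqr x : norm x ^+ 2 = dot x x.
Proof. exact/sqr_sqrtr/dot_ge0. Qed.

Lemma normD x y : norm (x + y) <= norm x + norm y.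
Proof.
have := eucl_dist_triangle 0 x (- y).
by rewrite !eucl_distE opprK subr0 add0r.
Qed.

Lemma normZ a x : 0 <= a -> norm (a *: x) = a * norm x.
Proof.
move=> a0; rewrite /norm !dotE mulrA -expr2 sqrtrM ?sqr_ge0 //.
by rewrite sqrtr_sqr ger0_norm.
Qed.

Lemma normN x : norm (- x) = norm x.
Proof. by rewrite /norm !dotE opprK. Qed.

Lemma normMn x (k : nat) : norm (x *+ k) = norm x *+ k.
Proof. by rewrite -scaler_nat normZ // mulr_natl. Qed.

Lemma normB x y : norm (x - y) <= norm x + norm y.
Proof. by rewrite -[norm y]normN normD. Qed.

Lemma norm0 : norm 0 = 0.
Proof. by rewrite -(scale0r 0) normZ // mul0r. Qed.

Lemma norm_eq0 x : norm x = 0 -> x = 0.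
Proof. by move=> x0; apply: eucl_dist_eq0; rewrite eucl_distE subr0. Qed.

Lemma dot_eq0 x : dot x x = 0 -> x = 0.
Proof. by move=> x0; apply: norm_eq0; rewrite /norm x0 sqrtr0. Qed.

Lemma norm_eq1 x : (norm x == 1) = (dot x x == 1).
Proof. by rewrite -norm_sqr sqrp_eq1 ?norm_ge0. Qed.

Definition horizontal x := x 0 ord_max = 0.

Definition vertical x := forall i, i != ord_max -> x 0 i = 0.

Lemma horizontalD x y : horizontal x -> horizontal y -> horizontal (x + y).
Proof. by rewrite /horizontal mxE => -> ->; rewrite addr0. Qed.

Lemma horizontalZ a x : horizontal x -> horizontal (a *: x).
Proof. by rewrite /horizontal mxE => ->; rewrite mulr0. Qed.

Lemma horizontalN x : horizontal x -> horizontal (- x).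
Proof. by rewrite /horizontal mxE => ->; rewrite oppr0. Qed.

Lemma verticalD x y : vertical x -> vertical y -> vertical (x + y).
Proof. by move=> hx hy i hi; rewrite mxE hx // hy // addr0. Qed.

Lemma verticalP x :
  vertical x <-> (forall w, horizontal w -> dot x w = 0).
Proof.
split=> [hx w hw|hx i hi].
  apply: big1 => i _; have [->|/hx ->] := eqVneq i ord_max; last exact: mul0r.
  by rewrite hw mulr0.
by rewrite -dot_delta hx // /horizontal mxE eqxx /= eq_sym (negPf hi).
Qed.

Lemma vertical_dot_eq x y :
  vertical x -> vertical y -> dot x x = dot y y -> x = y \/ x = - y.
Proof.
have sq z : vertical z -> dot z z = z 0 ord_max ^+ 2.
  move=> hz; rewrite /dot (bigD1 ord_max) //= big1 ?addr0 ?expr2 // => i hi.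
  by rewrite hz // mul0r.
move=> hx hy; rewrite !sq // => /eqP; rewrite eqf_sqr => /orP[]/eqP e.
  left; apply/rowP => i; have [->//|hi] := eqVneq i ord_max.
  by rewrite hx // hy.
right; apply/rowP => i; rewrite mxE; have [->//|hi] := eqVneq i ord_max.
by rewrite hx // hy // oppr0.
Qed.

Lemma horizontal_vertical_split x :
  exists2 w, horizontal w & vertical (x - w).
Proof.
exists (x - x 0 ord_max *: delta_mx 0 ord_max).
  by rewrite /horizontal !mxE !eqxx mulr1 subrr.
by move=> i hi; rewrite !mxE eqxx (negPf hi) /= mulr0 subr0 subrr.
Qed.

Hypothesis n2 : (2 <= n)%N.

(** The horizontal space has dimension at least 2, so it contains a nonzero vector orthogonal to
    [z], which is then rescaled. *)
Lemma horizontal_perp z c : 0 <= c ->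
  exists f, [/\ horizontal f, dot f z = 0 & dot f f = c].
Proof.
move=> c0.
suff [g [hg gz g0]] : exists g, [/\ horizontal g, dot g z = 0 & dot g g != 0].
  exists ((Num.sqrt c / norm g) *: g); split.
  - exact: horizontalZ.
  - by rewrite !dotE gz mulr0.
  - rewrite !dotE mulrA -expr2 expr_div_n norm_sqr sqr_sqrtr //.
    by rewrite mulfVK.
pose i0 : 'I_n.+1 := ord0; pose i1 : 'I_n.+1 := inord 1.
have v1 : i1 = 1%N :> nat by rewrite inordK // ltnS ltnW.
have h0 : i0 != ord_max by rewrite -val_eqE /= eq_sym -lt0n ltnW.
have h1 : i1 != ord_max by rewrite -val_eqE /= v1 neq_ltn n2.
have h01 : i0 != i1 by rewrite -val_eqE /= v1.
have [e|ne] := eqVneq (z 0 i0) 0.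
  exists (delta_mx 0 i0); split.
  - by rewrite /horizontal mxE eqxx /= eq_sym (negPf h0).
  - by rewrite dotC dot_delta.
  - by rewrite dot_delta mxE !eqxx oner_eq0.
(* The quarter turn of the projection of [z] onto the plane of the coordinates [i0] and [i1], both
   horizontal because [n >= 2]. *)
exists (z 0 i1 *: delta_mx 0 i0 - z 0 i0 *: delta_mx 0 i1); split.
- rewrite /horizontal !mxE eqxx /= ![ord_max == _]eq_sym.
  by rewrite (negPf h0) (negPf h1) !mulr0 subrr.
- by rewrite dotC !dotE !dot_delta; ring.
- have h10 : (i1 == i0) = false by rewrite eq_sym (negPf h01).
  rewrite !dotE !dot_delta !mxE !eqxx /= (negPf h01) h10 /=.
  rewrite !mulr0 !mulr1 subr0 oppr0 mulr0 add0r mulrN opprK -!expr2.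
  by rewrite gt_eqF // ltr_wpDl ?sqr_ge0 // exprn_even_gt0.
Qed.

(** [w / m] is the diagonal of a rhombus of side [r]: its sides are [w / (2m) + f] and
    [w / (2m) - f] with [f] orthogonal to [w]. Choosing [m > |w| / r] makes half the diagonal
    shorter than [r]. *)
Lemma horizontal_decomp r w : 0 < r -> horizontal w ->
  exists (m : nat) u v, [/\ horizontal u, horizontal v, norm u = r, norm v = r
    & w = (u + v) *+ m].
Proof.
move=> r0 hw; pose m := (Num.truncn (norm w / r)).+1.
have m0 : 0 < m%:R :> R by rewrite ltr0n.
have lem : norm w <= r * m%:R.
  by rewrite mulrC -ler_pdivrMr //; apply/ltW/truncnS_gt.
have /(horizontal_perp w)[f [hf fw ff]] :
    0 <= r ^+ 2 - dot w w / (2 * m%:R) ^+ 2.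
  rewrite subr_ge0 ler_pdivrMr ?exprn_gt0 ?mulr_gt0 // -norm_sqr -exprMn.
  rewrite lerXn2r ?nnegrE ?norm_ge0 // ?mulr_ge0 ?ltW //.
  by apply: le_lt_trans lem _; nra.
exists m, ((2 * m%:R)^-1 *: w + f), ((2 * m%:R)^-1 *: w - f).
have N s : s ^+ 2 = 1 -> norm ((2 * m%:R)^-1 *: w + s *: f) = r.
  move=> s1; rewrite -[r]gtr0_norm // -sqrtr_sqr; congr Num.sqrt.
  rewrite dot_pythagoras; last by rewrite dotC.
  by rewrite s1 ff exprVn; ring.
split.
- by apply: horizontalD => //; apply: horizontalZ.
- by apply: horizontalD; [apply: horizontalZ|apply: horizontalN].
- by rewrite -[f]scale1r N // expr1n.
- by rewrite -scaleN1r N // sqrrN expr1n.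
- rewrite addrACA subrr addr0 -scalerDl -scaler_nat scalerA.
  rewrite -[LHS]scale1r; congr (_ *: _); field.
  by rewrite gt_eqF.
Qed.

End Euclidean.

(** The Archimedean property, in the form used to let progressions run to infinity. *)
Lemma mulrn_bounded_le0 (R : realType) (a b : R) :
  (forall k : nat, a *+ k <= b) -> a <= 0.
Proof.
move=> hk; rewrite leNgt; apply/negP => a0.
have := hk (Num.truncn (b / a)).+1; apply/negP; rewrite -ltNge -mulr_natl.
by rewrite -ltr_pdivrMr //; apply: truncnS_gt.
Qed.

(** * Common neighbours and midpoints in the layer *)

Section LayerAutomorphism.
Context {R : realType} {n : nat} (eps : R).
Hypotheses (n2 : (2 <= n)%N) (eps0 : 0 < eps).
Local Notation V := 'rV[R]_n.+1.
Implicit Types (p q x y z u v w : V).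

Definition in_layer x := 0 <= x 0 ord_max <= eps.

Definition adj x y := dot (x - y) (x - y) = 1.

(* [F] and [G] are total on R^(n+1), with junk values outside the layer. *)
Record layer_aut (F G : V -> V) : Prop := LayerAut {
  aut_in : forall x, in_layer x -> in_layer (F x) ;
  aut_inV : forall x, in_layer x -> in_layer (G x) ;
  autK : forall x, in_layer x -> G (F x) = x ;
  autVK : forall x, in_layer x -> F (G x) = x ;
  aut_adj : forall x y, in_layer x -> in_layer y ->
    adj (F x) (F y) <-> adj x y }.

Lemma layer_aut_sym F G : layer_aut F G -> layer_aut G F.
Proof.
case=> iF iG FK GK adjF; split=> // x y hx hy.
by rewrite -(adjF (G x) (G y)) ?GK //; apply: iG.
Qed.

Lemma in_layerD x w : horizontal w -> in_layer x -> in_layer (x + w).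
Proof. by rewrite /in_layer mxE => ->; rewrite addr0. Qed.

Lemma in_layer_conv (t : R) x y : 0 <= t -> t <= 1 ->
  in_layer x -> in_layer y -> in_layer (x + t *: (y - x)).
Proof.
rewrite /in_layer !mxE => t0 t1 /andP[x0 x1] /andP[y0 y1].
by apply/andP; split; nra.
Qed.

Lemma in_layer0 : in_layer 0.
Proof. by rewrite /in_layer mxE lexx ltW. Qed.

Lemma adj_norm x y : adj x y -> norm (x - y) = 1.
Proof. by rewrite /adj /norm => ->; rewrite sqrtr1. Qed.

(** From the midpoint [o], moving along a horizontal [f] orthogonal to [x - y] stays in the layer;
    Pythagoras fixes the length of [f]. The values [s = 1] and [s = -1] give two neighbours, which
    coincide only if [f = 0]. *)
Lemma common_neighbours x y : in_layer x -> in_layer y -> norm (x - y) <= 2 ->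
  exists f, let o := x + 2^-1 *: (y - x) in forall s : R, s ^+ 2 = 1 ->
    [/\ in_layer (o + s *: f), adj (o + s *: f) x & adj (o + s *: f) y].
Proof.
move=> hx hy d2.
have /(horizontal_perp n2 (x - y))[f [hf fz ff]] :
    0 <= 1 - dot (x - y) (x - y) / 4.
  by rewrite -norm_sqr; have := norm_ge0 (x - y); nra.
exists f => o s s1; rewrite /o; split.
- by apply: in_layerD; [exact: horizontalZ|apply: in_layer_conv => //; lra].
- have -> : x + 2^-1 *: (y - x) + s *: f = x + (s *: f + - 2^-1 *: (x - y)).
    by apply/rowP => i; rewrite !mxE; lra.
  by rewrite /adj addrAC subrr add0r dot_pythagoras // s1 ff sqrrN; lra.
- have -> : x + 2^-1 *: (y - x) + s *: f = y + (s *: f + 2^-1 *: (x - y)).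
    by apply/rowP => i; rewrite !mxE; lra.
  by rewrite /adj addrAC subrr add0r dot_pythagoras // s1 ff; lra.
Qed.

(** If [b] is the midpoint, then [|m - a|^2 + |m - c|^2 = 2 |m - b|^2 + 2], which forces [m = b].
    Conversely, uniqueness identifies both neighbours [o + f] and [o - f] with [b], so [b = o]. The
    right-hand side speaks of adjacency only. *)
Lemma midpointP a b c :
  in_layer a -> in_layer b -> in_layer c -> adj b a -> adj b c ->
  a + c = b + b <->
  (forall m, in_layer m -> adj m a -> adj m c -> m = b).
Proof.
move=> ha hb hc ba bc; split=> [e m hm ma mc|uniq].
  apply/eqP; rewrite -subr_eq0; apply/eqP/dot_eq0.
  have ec : c = b + b - a by rewrite -e addrAC subrr add0r.
  move: ba bc ma mc; rewrite /adj ec !dotE.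
  rewrite (dotC b m) (dotC a b) (dotC a m); lra.
have d2 : norm (a - c) <= 2.
  have -> : a - c = (b - c) + - (b - a).
    by apply/rowP => i; rewrite !mxE; lra.
  by apply: le_trans (normD _ _) _; rewrite normN !adj_norm //; lra.
have [f com] := common_neighbours ha hc d2.
have [] := com 1; first by rewrite expr1n.
move=> /uniq/[apply]/[apply] e1.
have [] := com (-1); first by rewrite sqrrN expr1n.
move=> /uniq/[apply]/[apply] e2.
apply/rowP => i; move: e1 e2 => /rowP/(_ i) + /rowP/(_ i).
by rewrite !mxE; lra.
Qed.

(** * Images of unit progressions and a coarse distance bound *)

Section Fixed.
Variables F G : V -> V.
Hypothesis FG : layer_aut F G.

Lemma aut_midpoint a b c :
  in_layer a -> in_layer b -> in_layer c -> adj b a -> adj b c ->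
  a + c = b + b -> F a + F c = F b + F b.
Proof.
move=> ha hb hc ba bc /(midpointP ha hb hc ba bc) uniq.
have [iF iG FK GK adjF] := FG.
apply/midpointP; rewrite ?adjF //; try exact: iF.
move=> m hm; rewrite -(GK m) // => ma mc; congr F.
by apply: uniq; first exact: iG; apply/adjF => //; apply: iG.
Qed.

Lemma aut_progression p u (k : nat) :
  in_layer p -> horizontal u -> norm u = 1 ->
  F (p + u *+ k) = F p + (F (p + u) - F p) *+ k.
Proof.
move=> hp hu u1.
have uu : dot u u = 1 by rewrite -norm_sqr u1 expr1n.
have hk m : in_layer (p + u *+ m).
  by apply: in_layerD => //; rewrite -scaler_nat; apply: horizontalZ.
(* Each new term is determined by the two before it, so the induction carries two consecutive
   terms. *)
suff [] : F (p + u *+ k) = F p + (F (p + u) - F p) *+ k /\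
  F (p + u *+ k.+1) = F p + (F (p + u) - F p) *+ k.+1 by [].
elim: k => [|k [IH1 IH2]].
  by rewrite !mulr0n !addr0 !mulr1n addrCA subrr addr0.
split=> //.
have : F (p + u *+ k) + F (p + u *+ k.+2) =
    F (p + u *+ k.+1) + F (p + u *+ k.+1).
  apply: aut_midpoint => //; rewrite /adj.
  - by rewrite mulrS addrCA addrK.
  - by rewrite [u *+ k.+2]mulrS addrCA -opprB addrK dotNl dotNr opprK.
  - by rewrite addrACA -mulrnDr addrACA -mulrnDr addnS addSn.
rewrite IH1 IH2 => /(canRL (addKr _)) ->.
by apply/rowP => i; rewrite !mulrS !mxE; lra.
Qed.

Lemma aut_unit p u : in_layer p -> horizontal u -> norm u = 1 ->
  norm (F (p + u) - F p) = 1.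
Proof.
move=> hp hu u1; apply: adj_norm; apply/(aut_adj FG) => //.
  exact: in_layerD.
by rewrite /adj addrAC subrr add0r -norm_sqr u1 expr1n.
Qed.

(** All points [F p + k d] lie in a layer of bounded height, so [d] has no vertical component. *)
Lemma aut_unit_horizontal p u : in_layer p -> horizontal u -> norm u = 1 ->
  horizontal (F (p + u) - F p).
Proof.
move=> hp hu u1; set d := F (p + u) - F p.
have hk (k : nat) : 0 <= F p 0 ord_max + d 0 ord_max *+ k <= eps.
  have : in_layer (F (p + u *+ k)).
    apply: (aut_in FG); apply: in_layerD => //.
    by rewrite -scaler_nat; apply: horizontalZ.
  by rewrite aut_progression // /in_layer -/d mxE -scaler_nat mxE mulr_natl.
have /andP[p0 p1] : in_layer (F p) by exact: (aut_in FG).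
apply/eqP; rewrite eq_le; apply/andP; split.
  by apply: (@mulrn_bounded_le0 _ _ eps) => k; have := hk k; lra.
rewrite -oppr_le0; apply: (@mulrn_bounded_le0 _ _ eps) => k.
by rewrite mulNrn; have := hk k; lra.
Qed.

(** Such points are joined by a path of at most [k + 2] edges: unit steps along the segment until
    the remaining distance is at most 2, then two edges through a common neighbour. [F] preserves
    the path. *)
Lemma aut_bound_nat (k : nat) p q : in_layer p -> in_layer q ->
  norm (p - q) <= k%:R + 2 -> norm (F p - F q) <= k%:R + 2.
Proof.
elim: k p q => [|k IH] p q hp hq.
  rewrite add0r => /(common_neighbours hp hq)[f /(_ 1)].
  rewrite expr1n => /(_ erefl)[]; set o := _ + 1 *: f => ho.
  move=> /(aut_adj FG ho hp)/adj_norm op /(aut_adj FG ho hq)/adj_norm oq.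
  have -> : F p - F q = (F o - F q) - (F o - F p).
    by apply/rowP => i; rewrite !mxE; lra.
  by apply: le_trans (normB _ _) _; rewrite op oq; lra.
rewrite -natr1; have [le2 _|gt2 led] := leP (norm (p - q)) (k%:R + 2).
  by apply: le_trans (IH _ _ hp hq le2) _; lra.
have k0 : 0 <= k%:R :> R by exact: ler0n.
set d := norm (p - q) in gt2 led; have d0 : 0 < d by lra.
have d1 : d^-1 <= 1 by rewrite invf_le1 //; lra.
have dd : dot (p - q) (p - q) = d ^+ 2 by rewrite norm_sqr.
pose o := p + d^-1 *: (q - p).
have ho : in_layer o by apply: in_layer_conv; rewrite // invr_ge0 ltW.
have po : adj (F p) (F o).
  apply/(aut_adj FG) => //; rewrite /adj.
  have -> : p - o = d^-1 *: (p - q) by apply/rowP => i; rewrite !mxE; lra.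
  by rewrite dotZl dotZr dd; field; rewrite gt_eqF.
have : norm (F o - F q) <= k%:R + 2.
  apply: IH => //.
  have -> : o - q = (1 - d^-1) *: (p - q).
    by apply/rowP => i; rewrite !mxE; lra.
  rewrite normZ ?subr_ge0 // -/d mulrBl mul1r mulVf ?gt_eqF //; lra.
have -> : F p - F q = (F p - F o) + (F o - F q) by rewrite addrA subrK.
by have := normD (F p - F o) (F o - F q); rewrite (adj_norm po); lra.
Qed.

(* Graph distance and Euclidean distance differ by at most 2, because the
   layer is convex. *)
Lemma aut_bound p q : in_layer p -> in_layer q ->
  norm (F p - F q) <= norm (p - q) + 2.
Proof.
move=> hp hq; have := truncn_itv (norm_ge0 (p - q)).
rewrite -natr1 => /andP[h1 h2].
by have := @aut_bound_nat (Num.truncn (norm (p - q))) p q hp hq; lra.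
Qed.

(* Comparing far-away points [p + k u] and [q + k v], the bounded error of
   [aut_bound] disappears after division by [k]. *)
Lemma aut_directions_le p q u v : in_layer p -> in_layer q ->
  horizontal u -> horizontal v -> norm u = 1 -> norm v = 1 ->
  norm ((F (p + u) - F p) - (F (q + v) - F q)) <= norm (u - v).
Proof.
move=> hp hq hu hv u1 v1; set u' := F (p + u) - _; set v' := F (q + v) - _.
rewrite -subr_le0.
apply: (@mulrn_bounded_le0 _ _ (norm (p - q) + 2 + norm (F p - F q))) => k.
have hk x w : in_layer x -> horizontal w -> in_layer (x + w *+ k).
  move=> hx hw; apply: in_layerD => //.
  by rewrite -scaler_nat; apply: horizontalZ.
have := aut_bound (hk _ _ hp hu) (hk _ _ hq hv).
rewrite !aut_progression // -/u' -/v' [(_ - norm _) *+ _]mulrnBl -!normMn.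
have -> : p + u *+ k - (q + v *+ k) = (p - q) + (u - v) *+ k.
  by rewrite mulrnBl opprD addrACA.
have -> : F p + u' *+ k - (F q + v' *+ k) = (F p - F q) + (u' - v') *+ k.
  by rewrite [(u' - _) *+ _]mulrnBl opprD addrACA.
have := normD (p - q) ((u - v) *+ k).
have := normB ((F p - F q) + (u' - v') *+ k) (F p - F q).
by rewrite [_ + _ *+ _ - (F p - F q)]addrAC subrr add0r; lra.
Qed.

End Fixed.

(** * Action of the automorphism on horizontal translations *)

Definition shift (F : V -> V) w := F w - F 0.

Section Rigidity.
Variables F G : V -> V.
Hypothesis FG : layer_aut F G.

Local Notation T := (shift F).

(** The reverse inequality is [aut_directions_le] for the inverse [G], at [F p] and [F q] with the
    image directions, which are again horizontal unit vectors. *)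
Lemma aut_directions p q u v : in_layer p -> in_layer q ->
  horizontal u -> horizontal v -> norm u = 1 -> norm v = 1 ->
  norm ((F (p + u) - F p) - (F (q + v) - F q)) = norm (u - v).
Proof.
move=> hp hq hu hv u1 v1; apply/eqP; rewrite eq_le (aut_directions_le FG) //=.
have GF := layer_aut_sym FG; have [iF _ FK _ _] := FG.
have := @aut_directions_le G F GF (F p) (F q)
  (F (p + u) - F p) (F (q + v) - F q).
rewrite ![F p + _]addrC ![F q + _]addrC !subrK !FK //; try exact: in_layerD.
rewrite ![p + _]addrC ![q + _]addrC !addrK; apply.
- exact: iF.
- exact: iF.
- by rewrite addrC; apply: (aut_unit_horizontal FG).
- by rewrite addrC; apply: (aut_unit_horizontal FG).
- by rewrite addrC; apply: (aut_unit FG).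
- by rewrite addrC; apply: (aut_unit FG).
Qed.

(** The case [v = u], [q = 0] of [aut_directions]: the two image directions are at distance 0. *)
Lemma aut_unit_shift p u : in_layer p -> horizontal u -> norm u = 1 ->
  F (p + u) = F p + T u.
Proof.
move=> hp hu u1; have := aut_directions hp in_layer0 hu hu u1 u1.
rewrite subrr norm0 add0r => /norm_eq0/eqP; rewrite subr_eq0 => /eqP e.
by rewrite /shift -e addrCA subrr addr0.
Qed.

Lemma unit_shiftN u : horizontal u -> norm u = 1 -> T (- u) = - T u.
Proof.
move=> hu u1.
have := aut_unit_shift (in_layerD (horizontalN hu) in_layer0) hu u1.
by rewrite add0r addNr => e; rewrite {1}/shift e opprD addrA subrr add0r.
Qed.

(** A walk from [p] with alternating unit steps [u] and [v] stays in the layer, and each step moves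
    the image by [T u] or [T v]. *)
Lemma unit_shift_decomp w : horizontal w -> exists (m : nat) u v,
  [/\ horizontal u, horizontal v, norm u = 1, norm v = 1 &
    w = (u + v) *+ m /\
    (forall p, in_layer p -> F (p + w) = F p + (T u + T v) *+ m)].
Proof.
move=> /(horizontal_decomp n2 ltr01)[m [u [v [hu hv u1 v1 ->]]]].
exists m, u, v; split=> //; split=> // p hp.
elim: m => [|m IH]; first by rewrite !mulr0n !addr0.
have hm : in_layer (p + (u + v) *+ m).
  by apply: in_layerD => //; rewrite -scaler_nat; apply/horizontalZ/horizontalD.
rewrite !mulrSr (addrA p) (addrA (F p)) -IH (addrA _ u) (addrA _ (T u)).
by rewrite (aut_unit_shift (in_layerD hu hm) hv v1) (aut_unit_shift hm hu u1).
Qed.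

Lemma shift_decomp w : horizontal w -> exists (m : nat) u v,
  [/\ horizontal u /\ norm u = 1, horizontal v /\ norm v = 1,
    w = (u + v) *+ m, T w = (T u + T v) *+ m &
    forall p, in_layer p -> F (p + w) = F p + T w].
Proof.
move=> /unit_shift_decomp[m [u [v [hu hv u1 v1 [ew sh]]]]].
have Tw : T w = (T u + T v) *+ m.
  by rewrite {1}/shift -[w]add0r sh ?in_layer0 // addrAC subrr add0r.
by exists m, u, v; split=> // p hp; rewrite Tw sh.
Qed.

Lemma aut_shift p w : in_layer p -> horizontal w -> F (p + w) = F p + T w.
Proof. by move=> hp /shift_decomp[m [u [v [_ _ _ _ ->]]]]. Qed.

(** For unit [u] and [v], [|T u + T v| = |T u - T (- v)| = |u + v|] by [aut_directions]; multiplying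
    by [m] covers every [w]. *)
Lemma shift_norm w : horizontal w -> norm (T w) = norm w.
Proof.
move=> /shift_decomp[m [u [v [[hu u1] [hv v1] -> -> _]]]].
rewrite !normMn; congr (_ *+ _).
have v1N : norm (- v) = 1 by rewrite normN.
have := aut_directions in_layer0 in_layer0 hu (horizontalN hv) u1 v1N.
by rewrite !add0r -/(shift F u) -/(shift F (- v)) unit_shiftN // !opprK.
Qed.

Lemma shift_horizontal w : horizontal w -> horizontal (T w).
Proof.
have h x : horizontal x -> norm x = 1 -> horizontal (T x).
  move=> hx x1; rewrite /shift -[x]add0r.
  exact: (aut_unit_horizontal FG in_layer0).
move=> /shift_decomp[m [u [v [[hu u1] [hv v1] _ -> _]]]].
by rewrite -scaler_nat; apply/horizontalZ/horizontalD; apply: h.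
Qed.

Lemma shiftD v w : horizontal v -> horizontal w -> T (v + w) = T v + T w.
Proof.
move=> hv hw; rewrite {1}/shift aut_shift //; first by rewrite addrAC.
by rewrite -[v]add0r; apply: in_layerD => //; apply: in_layer0.
Qed.

Lemma shiftN w : horizontal w -> T (- w) = - T w.
Proof.
move=> hw; apply/eqP; rewrite -addr_eq0 -shiftD //; last exact: horizontalN.
by rewrite addNr /shift subrr.
Qed.

Lemma shiftMn w m : horizontal w -> T (w *+ m) = T w *+ m.
Proof.
move=> hw; elim: m => [|m IH]; first by rewrite !mulr0n /shift subrr.
by rewrite !mulrS shiftD ?IH // -scaler_nat; apply: horizontalZ.
Qed.

End Rigidity.

(** * Vertical segments and preservation of all distances *)

Section Vertical.
Variables F G : V -> V.
Hypothesis FG : layer_aut F G.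

Local Notation T := (shift F).

Lemma shift_surj y : horizontal y -> exists2 w, horizontal w & T w = y.
Proof.
move=> hy; have GF := layer_aut_sym FG; have [iF _ FK GK _] := FG.
have iF0 : in_layer (F 0) by apply/iF/in_layer0.
(* This is the shift of the inverse [G] along [y], measured at the base point [F 0]. *)
exists (G (F 0 + y) - G (F 0)).
  rewrite (aut_shift GF) // addrAC subrr add0r.
  exact: (shift_horizontal GF).
rewrite FK ?in_layer0 // subr0 /shift GK ?(in_layerD hy) //.
by rewrite addrAC subrr add0r.
Qed.

(* If [r^2 + |q - p|^2 = 1], then [p] is adjacent to [q + w] and [q - w] for all
   horizontal [w] of norm [r], hence [F p] to [F q + T w] and [F q - T w]. *)
Lemma aut_vertical_near p q : in_layer p -> in_layer q -> vertical (q - p) ->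
  norm (q - p) < 1 ->
  vertical (F q - F p) /\ norm (F q - F p) = norm (q - p).
Proof.
move=> hp hq vz z1; set z := q - p in vz z1 *; set b := F q - F p.
have z0 : 0 <= norm z by exact: norm_ge0.
have r0 : 0 < 1 - norm z ^+ 2 by nra.
have sphere w : horizontal w -> norm w ^+ 2 = 1 - norm z ^+ 2 ->
    dot (b + T w) (b + T w) = 1.
  move=> hw wr; have hqw : in_layer (q + w) by exact: in_layerD.
  have : adj (F (q + w)) (F p).
    apply/(aut_adj FG) => //; rewrite /adj addrAC -/z.
    rewrite dot_sqrD ((verticalP z).1 vz w hw) mulr0 addr0.
    by rewrite -!norm_sqr wr addrC subrK.
  by rewrite /adj (aut_shift FG) // addrAC.
(* Subtracting the sphere identities for [w] and [- w] gives the orthogonality; adding them gives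
   the norm of [b]. *)
have orth w : horizontal w -> norm w ^+ 2 = 1 - norm z ^+ 2 ->
    dot b (T w) = 0 /\ norm b ^+ 2 = norm z ^+ 2.
  move=> hw wr; have := sphere _ (horizontalN hw).
  rewrite normN => /(_ wr); have := sphere _ hw wr.
  have wT : dot (T w) (T w) = 1 - norm z ^+ 2.
    by rewrite -norm_sqr (shift_norm FG).
  rewrite (shiftN FG) // (dot_sqrD b (T w)) (dot_sqrD b (- T w)).
  by rewrite dotNl !dotNr opprK wT -norm_sqr; lra.
split.
  apply/verticalP => _ /shift_surj[w hw <-].
  (* Vectors of the one admissible length generate the horizontal space additively, so orthogonality
     extends to all of it. *)
  have [|m [u [v [hu hv ur vr ->]]]] := @horizontal_decomp R n n2
     (Num.sqrt (1 - norm z ^+ 2)) w _ hw; first by rewrite sqrtr_gt0.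
  rewrite (shiftMn FG) ?(shiftD FG) //; last exact: horizontalD.
  rewrite -scaler_nat dotZr dotDr.
  have ur2 : norm u ^+ 2 = 1 - norm z ^+ 2 by rewrite ur sqr_sqrtr ?ltW.
  have vr2 : norm v ^+ 2 = 1 - norm z ^+ 2 by rewrite vr sqr_sqrtr ?ltW.
  have [[-> _] [-> _]] := (orth u hu ur2, orth v hv vr2).
  by rewrite addr0 mulr0.
have [f [hf _ ff]] := horizontal_perp n2 0 (ltW r0).
apply/eqP; rewrite -(@eqrXn2 _ 2) ?norm_ge0 //; apply/eqP.
by have [] := orth f hf (etrans (norm_sqr f) ff).
Qed.

(** Cut the segment at its midpoint. The images of the halves are vertical of equal length, hence
    equal or opposite. Opposite images would give [F q = F p], so [q = p] by injectivity and both
    lengths are 0. *)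
Lemma aut_vertical_pow (k : nat) p q : in_layer p -> in_layer q ->
  vertical (q - p) -> norm (q - p) < 2 ^+ k ->
  vertical (F q - F p) /\ norm (F q - F p) = norm (q - p).
Proof.
elim: k p q => [|k IH] p q hp hq vz; first exact: aut_vertical_near.
rewrite exprS => lt2.
pose m := p + 2^-1 *: (q - p).
have hm : in_layer m by apply: in_layer_conv => //; lra.
have vhalf : vertical (2^-1 *: (q - p)) by move=> i hi; rewrite mxE vz ?mulr0.
have nhalf : norm (2^-1 *: (q - p)) = 2^-1 * norm (q - p).
  by rewrite normZ // invr_ge0.
have mp : m - p = 2^-1 *: (q - p) by rewrite addrAC subrr add0r.
have qm : q - m = 2^-1 *: (q - p) by apply/rowP => i; rewrite !mxE; lra.
have hlt : norm (2^-1 *: (q - p)) < 2 ^+ k by rewrite nhalf; lra.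
have := IH p m hp hm; rewrite mp => /(_ vhalf hlt)[v1 n1].
have := IH m q hm hq; rewrite qm => /(_ vhalf hlt)[v2 e2].
have e : F q - F p = (F m - F p) + (F q - F m).
  by rewrite [RHS]addrC addrA subrK.
split; first by rewrite e; apply: verticalD.
have [|d|d] := vertical_dot_eq v1 v2.
- by rewrite -!norm_sqr n1 e2.
- rewrite e d -mulr2n normMn e2 nhalf -mulr_natl; lra.
- have : F q = F p by apply/eqP; rewrite -subr_eq0 e d addNr.
  move/(congr1 G); rewrite !(autK FG) // => ->.
  by rewrite !subrr.
Qed.

Lemma aut_vertical p q : in_layer p -> in_layer q -> vertical (q - p) ->
  vertical (F q - F p) /\ norm (F q - F p) = norm (q - p).
Proof.
move=> hp hq vz; pose k := (Num.truncn (norm (q - p))).+1.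
apply: (@aut_vertical_pow k) => //; apply: lt_le_trans (truncnS_gt _) _.
by rewrite -natrX ler_nat ltnW // ltn_expl.
Qed.

(** Pythagoras: the vertical and horizontal parts of [q - p] keep their lengths and their images
    remain orthogonal. *)
Lemma aut_norm p q : in_layer p -> in_layer q ->
  norm (F q - F p) = norm (q - p).
Proof.
move=> hp hq; have [w hw vz] := horizontal_vertical_split (q - p).
have hqw : in_layer (q - w) by apply: in_layerD => //; apply: horizontalN.
have [|vF nF] := aut_vertical hp hqw; first by rewrite addrAC.
have eF : F q - F p = (F (q - w) - F p) + T w.
  by have := aut_shift FG hqw hw; rewrite subrK => ->; rewrite addrAC.
have e : q - p = (q - p - w) + w by rewrite subrK.
rewrite e eF /norm; congr Num.sqrt.
have hTw := shift_horizontal FG hw.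
rewrite (dot_sqrD _ (T w)) (dot_sqrD _ w) ((verticalP _).1 vF _ hTw).
rewrite ((verticalP _).1 vz _ hw) -!norm_sqr nF (shift_norm FG) //.
by rewrite [q - w - p]addrAC.
Qed.

End Vertical.

End LayerAutomorphism.

(** * Transfer from maps on the whole space to the layer *)

Theorem theorem3 (R : realType) (n : nat) (eps : R)
    (hn : (2 <= n)%N) (heps : 0 < eps)
    (phi : layer n eps -> layer n eps)
    (hphi : graph_automorphism (unit_distance_graph (layer n eps)) phi) :
  is_isometry phi.
Proof.
have [bij adjE] := hphi; split=> // x y.
have [psi phiK psiK] := bij.
pose o : layer n eps := Layer (@in_layer0 R n eps heps).
(* Points outside the layer are treated as the origin [o]. *)
pose lift (f : layer n eps -> layer n eps) z := val (f (insubd o z)).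
have inP (z : layer n eps) : in_layer eps (val z) by exact: valP.
have valK z : in_layer eps z -> val (insubd o z) = z by exact: insubdK.
have adjP (a b : layer n eps) :
    unit_distance_graph (layer n eps) a b <-> adj (val a) (val b).
  rewrite -[unit_distance_graph _ a b]/(mdist a b == 1).
  rewrite layer_mdistE eucl_distE norm_eq1; split; first by move/eqP.
  by move=> e; apply/eqP.
have aut : layer_aut eps (lift phi) (lift psi).
  split=> [z _|z _|z hz|z hz|a b ha hb]; rewrite /lift ?valKd ?inP //.
  - by rewrite phiK valK.
  - by rewrite psiK valK.
  - by rewrite -adjP adjE adjP !valK.
have := aut_norm hn heps aut (inP y) (inP x).
by rewrite /lift !valKd !layer_mdistE !eucl_distE.
Qed.
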